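(* For each finite non-empty set $X$, let $k=k(X)$ be an integer with $k\ge\frac{2\ln(2e)|X|}{\ln(|X|/2)}$, let $r_1,\ldots,r_k$ be independent random subsets of $X$ each with the Binomial$(X,1/2)$ distribution, and let $x\in X$ be arbitrary. Then the probability that $R:=\{\emptyset,\{x\},X\setminus\{x\},r_1,\ldots,r_k\}$ resolves $(2^X,\mathrm{Jac})$ tends to $1$ as $|X|\to\infty$.
   Context: For a finite set $X$, $2^X$ is its power set. The Jaccard distance on $2^X$ is $\mathrm{Jac}(a,b)=|a\,\Delta\, b|/|a\cup b|$ for $a\neq b$ and $\mathrm{Jac}(a,a)=0$, where $\Delta$ is symmetric difference. A non-empty set $R\subseteq 2^X$ resolves $(2^X,\mathrm{Jac})$ if the map $a\mapsto (\mathrm{Jac}(a,r))_{r\in R}$ is injective on $2^X$. A random $r\in 2^X$ has the Binomial$(X,1/2)$ distribution if $\mathbb{P}(x\in r)=1/2$ for each $x\in X$ and the events $[x\in r]$, $x\in X$, are independent. (The paper phrases the conclusion as ''with overwhelmingly high probability, as $|X|\to\infty$''.) *)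

(* Defs.v *)
From mathcomp Require Import all_boot all_order all_algebra.
From mathcomp Require Import all_classical all_reals all_analysis.

Set Implicit Arguments.
Unset Strict Implicit.
Unset Printing Implicit Defensive.

Import Order.TTheory GRing.Theory Num.Theory.
Import numFieldNormedType.Exports.

Local Open Scope classical_set_scope.
Local Open Scope ring_scope.

Record nefinType := NeFinType {
  nefin_sort :> finType;
  nefin_card_gt0 : (0 < #|nefin_sort|)%N }.

Section Jaccard.
Variables (R : realType) (X : finType).
Implicit Types a b : {set X}.

Definition symdiff a b : {set X} := ((a :\: b) :|: (b :\: a))%SET.

Definition jaccard a b : R :=
  if a == b then 0 else #|symdiff a b|%:R / #|(a :|: b)%SET|%:R.

Definition resolves (S : {set {set X}}) : Prop :=
  S != finset.set0 /\
  injective (fun a => [ffun s : {s : {set X} | s \in S} => jaccard a (val s)]).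

(* {emptyset, {x}, X \ {x}, r_1, ..., r_k} *)
Definition landmarks (x : X) (k : nat) (r : 'I_k -> {set X}) : {set {set X}} :=
  ([set finset.set0; [set x]; ~: [set x]] :|: [set r i | i : 'I_k])%SET.

End Jaccard.

Section RandomSubsets.
Variables (R : realType) (d : measure_display) (T : measurableType d).
Variable P : probability T R.

Definition independent_events (I : finType) (E : I -> set T) : Prop :=
  forall J : {set I},
    P (\bigcap_(i in [set` J]) E i) = (\prod_(i in J) P (E i))%E.

Variable X : finType.

(* Measurability with respect to the discrete sigma-algebra on 2^X. *)
Definition random_subset (r : T -> {set X}) : Prop :=
  forall A : set {set X}, measurable (r @^-1` A).

Definition independent_subsets (I : finType) (r : I -> T -> {set X}) : Prop :=
  forall A : I -> set {set X}, independent_events (fun i => r i @^-1` A i).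

Definition binomial_half (r : T -> {set X}) : Prop :=
  (forall x : X, P [set w | x \in r w] = (2^-1)%:E) /\
  independent_events (fun x : X => [set w | x \in r w]).

End RandomSubsets.

(* Main.v *)
(** Two distinct sets [a], [b] with the same distances to [{x}] and [X \ {x}]
    have the same size, and then equal distance to [r] means
    [|a ∩ r| = |b ∩ r|]. Removing [a ∩ b], a failure to resolve yields disjoint
    [a], [b] of common size [m >= 1] that every [r_i] meets equally often; for
    each [r_i] this has probability [C(2m, m) / 4^m <= (2m + 1)^(-1/2)].
    A union bound over the pairs [(a, b)] is split at [m = (n/2)^(7/8)]: below,
    the pairs are few, [(n + 1)^(2m)], against [3^(-k/2)]; above, the crude
    count [4^n] is beaten by [(2e)^(-7n/8)], because [ln 2 <= 3/4]. *)

Require Import Defs.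
From mathcomp Require Import all_boot all_order all_algebra.
From mathcomp Require Import all_classical all_reals all_analysis.
From mathcomp Require Import zify ring lra.

Import Order.TTheory GRing.Theory Num.Theory.
Import numFieldNormedType.Exports.

Local Open Scope ring_scope.

(** * Counting of sets, and what Jaccard distances reveal about sizes and intersections *)

Section Combinatorics.
Local Open Scope set_scope.
Variable X : finType.
Implicit Types a b s : {set X}.

Definition balanced a b : {set {set X}} :=
  [set s : {set X} | #|a :&: s| == #|b :&: s|].

(* Complementing s inside b turns |a ∩ s| = |b ∩ s| into |(a ∪ b) ∩ s| = |a|. *)
Lemma card_balanced_le {a b} : [disjoint a & b] -> #|a| = #|b| ->
  (#|balanced a b| * 4 ^ #|a| <= 'C(#|a|.*2, #|a|) * 2 ^ #|X|)%N.
Proof.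
move=> dab eab; set c := a :|: b; set m := #|a|.
have cc : #|c| = m.*2.
  by rewrite -addnn {2}/m eab; apply/eqP; rewrite leq_card_setU.
pose f s := ((a :&: s) :|: (b :\: s), s :\: c).
have finj : injective f.
  move=> s1 s2 [E1 E2]; apply/setP => x.
  move/setP/(_ x): E1; move/setP/(_ x): E2; rewrite !inE.
  have := disjointFr dab (x := x).
  case: (x \in a) => [/(_ isT) ->|_]; first by do 2!case: (_ \in _).
  by case: (x \in b); do 2!case: (_ \in _).
have fsub : (f @: balanced a b) \subset
    finset.setX [set A : {set X} | A \subset c & #|A| == m] (powerset (~: c)).
  apply/fintype.subsetP => _ /imsetP[s + ->]; rewrite !inE /= => /eqP es.
  rewrite finset.subsetDr andbT; apply/andP; split.
    apply: finset.setUSS; [exact: finset.subsetIl|exact: finset.subsetDl].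
  have d' : [disjoint (a :&: s) & (b :\: s)].
    rewrite -setI_eq0; apply/eqP/setP => x; rewrite !inE.
    by case: (x \in s); rewrite ?andbF.
  move: (leq_card_setU (a :&: s) (b :\: s)).
  rewrite d' => /leqifP/eqP ->.
  by rewrite es cardsID /m eab.
have := subset_leq_card fsub.
rewrite card_imset// cardsX cards_draws card_powerset cc => H.
have := cardsC c; rewrite cc => <-.
have -> : (2 ^ (m.*2 + #|~: c|) = 4 ^ m * 2 ^ #|~: c|)%N.
  by rewrite expnD -mul2n expnM.
by rewrite [leqRHS]mulnCA [leqLHS]mulnC leq_pmul2l ?expn_gt0.
Qed.

(** A set with at most [M] elements is the set of non-[None] values of a function from ['I_M] to
    [option X]: list its elements and pad with [None]. There are [#|X|.+1 ^ M] such functions. *)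
Lemma card_small_sets M :
  (#|[set a : {set X} | (#|a| <= M)%N]| <= (#|X|.+1) ^ M)%N.
Proof.
pose f (g : {ffun 'I_M -> option X}) : {set X} :=
  [set y | [exists i, g i == Some y]].
have : [set a : {set X} | (#|a| <= M)%N] \subset codom f.
  apply/fintype.subsetP => a; rewrite inE => aM.
  apply/codomP; exists [ffun i : 'I_M => nth None (map Some (enum a)) i].
  apply/setP => y; rewrite inE; apply/idP/existsP => [ya|[i]].
    have yi : (index y (enum a) < #|a|)%N.
      by rewrite cardE index_mem mem_enum.
    exists (Ordinal (leq_trans yi aM)); rewrite ffunE /=.
    rewrite (nth_map y) -?cardE// nth_index// mem_enum//.
  rewrite ffunE; case: (ltnP i (size (enum a))) => [ia|ia].
    rewrite (nth_map y)// => /eqP[<-].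
    by rewrite -mem_enum mem_nth.
  by rewrite nth_default ?size_map.
move=> /subset_leq_card/leq_trans; apply.
by rewrite (leq_trans (leq_image_card _ _))// card_ffun card_option card_ord.
Qed.

Variable R : realType.

(** On the diagonal the numerator vanishes, and the convention that division by 0 gives 0 covers two
    empty sets. *)
Lemma jaccardE a b :
  jaccard R a b = #|symdiff a b|%:R / #|a :|: b|%:R.
Proof.
rewrite /jaccard; case: eqP => // ->.
by rewrite /symdiff finset.setDv finset.setU0 cards0 mul0r.
Qed.

Lemma card_symdiffI a b :
  (#|symdiff a b| + #|a :&: b| = #|a :|: b|)%N.
Proof.
have := cardsID (symdiff a b) (a :|: b).
have -> : (a :|: b) :&: symdiff a b = symdiff a b.
  by apply/setP => x; rewrite !inE; do 2!case: (_ \in _).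
have -> // : (a :|: b) :\: symdiff a b = a :&: b.
by apply/setP => x; rewrite !inE; do 2!case: (_ \in _).
Qed.

(** For non-empty [s] the distance is [1 - |a ∩ s| / |a ∪ s|], so the ratios agree and can be
    cross-multiplied, the unions being non-empty. For empty [s] both intersections are empty. *)
Lemma jaccard_eq_cross {a b s} : jaccard R a s = jaccard R b s ->
  (#|a :&: s| * #|b :|: s| = #|b :&: s| * #|a :|: s|)%N.
Proof.
rewrite !jaccardE => E.
have [s0|s_neq0] := eqVneq s finset.set0; first by rewrite s0 !finset.setI0 cards0.
have pos c : (0 < #|c :|: s|)%N.
  by rewrite (leq_trans _ (subset_leq_card (finset.subsetUr c s)))// card_gt0.
move/eqP: E; rewrite eqr_div ?pnatr_eq0 ?gtn_eqF// -!natrM eqr_nat => /eqP E.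
move: (card_symdiffI a s) (card_symdiffI b s) => Ea Eb; nia.
Qed.

(** Substituting [|a ∪ s| = |a| + |s| - |a ∩ s|] in the cross-multiplied identity cancels the mixed
    product and leaves [(|a ∩ s| - |b ∩ s|) (|a| + |s|) = 0]; the second factor is positive unless
    [a] and [b] are empty. *)
Lemma jaccard_eq_cardI {a b s} : #|a| = #|b| ->
  jaccard R a s = jaccard R b s -> #|a :&: s| = #|b :&: s|.
Proof.
move=> eab /jaccard_eq_cross E.
have [b0|b_gt0] := posnP #|b|.
  move: eab; rewrite b0 => /eqP; rewrite cards_eq0 => /eqP ->.
  by move/eqP: b0; rewrite cards_eq0 => /eqP ->.
move: (cardsUI a s) (cardsUI b s) => Ea Eb.
by move: E Ea Eb; rewrite eab; nia.
Qed.

(** The distance to [{x}] decides whether [x] belongs to the set, and if so gives the size. If [x]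
    is in neither set, both lie inside [X \ {x}], and the distance to that set gives the size, since
    [|X| - 1 > 0]. *)
Lemma jaccard_eq_card {a b x} : (1 < #|X|)%N ->
  jaccard R a [set x] = jaccard R b [set x] ->
  jaccard R a (~: [set x]) = jaccard R b (~: [set x]) -> #|a| = #|b|.
Proof.
move=> X_gt1 /jaccard_eq_cross E1 /jaccard_eq_cross.
have c1 c : #|c :&: [set x]| = (x \in c).
  have [xc|xc] := boolP (x \in c).
    by rewrite (finset.setIidPr _) ?cards1// finset.sub1set.
  apply/eqP; rewrite cards_eq0; apply/eqP/setP => y; rewrite !inE.
  by case: eqP => [->|]; rewrite ?andbF// (negbTE xc).
have c2 c : (#|c :|: [set x]| = #|c| + (x \notin c))%N.
  by have := cardsUI c [set x]; rewrite c1 cards1; case: (x \in c) => /=; lia.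
move: E1; rewrite !c1 !c2.
have [xa|xa] := boolP (x \in a); have [xb|xb] := boolP (x \in b) => //=.
- by lia.
- by rewrite !mul1n mul0n; lia.
- by rewrite !mul1n mul0n; lia.
move=> _; have sub (c : {set X}) : x \notin c -> c \subset (~: [set x]).
  move=> xc; apply/fintype.subsetP => y yc; rewrite !inE.
  by apply: contraNneq xc => <-.
rewrite !(finset.setIidPl (sub _ _))// !(finset.setUidPr (sub _ _))//.
have -> : #|~: [set x]| = #|X|.-1 by rewrite cardsC1.
move/eqP; rewrite eqn_mul2r => /orP[|/eqP//].
by lia.
Qed.

Lemma resolves_landmarks (x : X) k (r : 'I_k -> {set X}) : (1 < #|X|)%N ->
  (forall a b, [disjoint a & b] -> #|a| = #|b| -> (0 < #|a|)%N ->
    exists i, r i \notin balanced a b) ->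
  resolves R (landmarks x r).
Proof.
move=> X_gt1 unb; split.
  by apply/set0Pn; exists finset.set0; rewrite /landmarks !inE eqxx.
move=> a b /ffunP E.
have J s : s \in landmarks x r -> jaccard R a s = jaccard R b s.
  by move=> sS; have := E (exist _ s sS); rewrite !ffunE.
have eab : #|a| = #|b|.
  apply: (@jaccard_eq_card a b x) => //; apply: J;
    by rewrite /landmarks !inE eqxx ?orbT.
have eI i : #|a :&: r i| = #|b :&: r i|.
  by apply/jaccard_eq_cardI/J => //; rewrite /landmarks inE imset_f ?orbT.
have eD : #|a :\: b| = #|b :\: a|.
  have := cardsID b a; have := cardsID a b; rewrite finset.setIC eab; lia.
have [D0|D_gt0] := posnP #|a :\: b|.
  apply/eqP; rewrite finset.eqEsubset -!finset.setD_eq0 -!cards_eq0.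
  by rewrite -eD D0.
case: (unb (a :\: b) (b :\: a)) => // [|i].
  rewrite -setI_eq0; apply/eqP/setP => y; rewrite !inE.
  by do 2!case: (_ \in _).
rewrite inE => /eqP[].
(* Subtracting the part inside [a ∩ b], common to both sides, carries equality of intersections with
   [r i] over to the differences. *)
have split_cap c e : #|(c :\: e) :&: r i| =
    (#|c :&: r i| - #|c :&: e :&: r i|)%N.
  rewrite -(cardsID e (c :&: r i)).
  have -> : (c :&: r i) :&: e = c :&: e :&: r i by rewrite finset.setIAC.
  by rewrite finset.setIDAC addKn.
by rewrite !split_cap eI finset.setIC (finset.setIC b a) finset.setIC.
Qed.

End Combinatorics.

(** * Central binomial coefficients *)

Lemma bin_doubleS m :
  (m.+1 * 'C(m.+1.*2, m.+1) = 2 * m.*2.+1 * 'C(m.*2, m))%N.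
Proof.
have := mul_bin_diag m.+1.*2 m; have := mul_bin_down m.*2.+1 m.
rewrite doubleS /= => H1 H2.
have E : (m.*2.+1 - m = m.+1)%N by lia.
by rewrite -H2 -mulnA H1 E; lia.
Qed.

(** By [bin_doubleS], passing from [m] to [m + 1] multiplies the left side by
    [4 (2m + 1) (2m + 3) / (m + 1)^2], which is at most 16 because
    [(2m + 1) (2m + 3) = (2m + 2)^2 - 1]. *)
Lemma bin_double_sqr m : ('C(m.*2, m) ^ 2 * m.*2.+1 <= 16 ^ m)%N.
Proof.
elim: m => // m IH; have := bin_doubleS m.
move: ('C(_, _)) => u; move: ('C(_, _)) IH => v IH E.
rewrite -(leq_pmul2l (m := m.+1 ^ 2)) ?expn_gt0// mulnA -expnMn E.
rewrite [(16 ^ _)%N]expnS.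
apply: (@leq_trans (16 * m.+1 ^ 2 * (v ^ 2 * m.*2.+1))%N); last first.
  by rewrite [leqRHS]mulnCA -mulnA leq_pmul2l// leq_pmul2l ?expn_gt0.
rewrite !expnMn; have : (m.*2.+1 * m.+1.*2.+1 <= 4 * m.+1 ^ 2)%N by lia.
move=> /(leq_mul (leqnn (4 * m.*2.+1 * v ^ 2))); lia.
Qed.

(** * Real estimates for the two ranges of the union bound *)

Section Estimates.
Variable R : realType.
Implicit Types t : R.

(** Here [e^(3/4) = (e^(1/8))^6 >= (9/8)^6 > 2]. *)
Lemma ln2_le : ln 2 <= 3 / 4 :> R.
Proof.
rewrite -ler_expR lnK ?posrE//.
have -> : 3 / 4 = 6%:R * (8^-1) :> R by lra.
rewrite expRM_natl; apply: (@le_trans _ _ ((1 + 8^-1) ^+ 6)); first by lra.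
by apply: lerXn2r; rewrite ?nnegrE ?expR_ge0 ?expR_ge1Dx//; lra.
Qed.

(** The inequality [ln (1 + u) <= u] at [u = -2/3] even gives [ln 3 >= 2/3]. *)
Lemma ln3_ge : 2^-1 <= ln 3 :> R.
Proof.
have := @le_ln1Dx R (- (2 / 3)); have -> : 1 + - (2 / 3) = 3^-1 :> R by lra.
rewrite lnV ?posrE// => H.
have : - ln 3 <= - (2 / 3) :> R by apply: H; lra.
lra.
Qed.

Lemma expR_opp_lt y e : 0 < e -> e^-1 <= y -> expR (- y) < e :> R.
Proof.
move=> e0 ey; rewrite expRN invf_plt ?posrE ?expR_gt0//.
by apply: (le_lt_trans ey); apply: lt_le_trans (expR_ge1Dx y); lra.
Qed.

(** The fourth power of [e^(t/32) >= t/32] gives [t^4 / 2^20]. The threshold 4000 ensures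
    [t^2 >= 8 * 2^20], hence a lower bound [8 t^2], which exceeds [2 t^2 + 5 t]. *)
Lemma exp_dominates t : 4000 <= t -> t * (2 * (t + 2) + 1) <= expR (t / 8).
Proof.
move=> ht; have -> : t / 8 = 4%:R * (t / 32) by lra.
rewrite expRM_natl; apply: (@le_trans _ _ ((t / 32) ^+ 4)); last first.
  apply: lerXn2r; rewrite ?nnegrE ?expR_ge0//; first by lra.
  by apply: le_trans (expR_ge1Dx _); lra.
have h2 : 8 * 2 ^+ 20 <= t ^+ 2.
  by apply: (@le_trans _ _ (4000 ^+ 2)); [lra|apply: lerXn2r; rewrite ?nnegrE; lra].
have -> : (t / 32) ^+ 4 = (t ^+ 2 / 2 ^+ 20) * t ^+ 2.
  by field.
apply: (@le_trans _ _ (8 * t ^+ 2)); first by rewrite expr2; nra.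
by rewrite ler_wpM2r ?sqr_ge0// ler_pdivlMr// exprn_gt0.
Qed.

Lemma central_bin_ratio_sqr_le m :
  ('C(m.*2, m)%:R / 4 ^+ m) ^+ 2 <= (m.*2.+1%:R)^-1 :> R.
Proof.
rewrite expr_div_n -exprM mulnC exprM ler_pdivrMr ?exprn_gt0//.
rewrite mulrC ler_pdivlMr//; have := bin_double_sqr m.
have -> : 4 ^+ 2 = 16%:R :> R by lra.
by rewrite -(ler_nat R) natrM !natrX.
Qed.

(** The ratio is at most [(2m + 1)^(-1/2) <= e^(-c/2)]. The parameter [c] is taken as [1/2] for
    small [m] and as [7t/8] for large [m]. *)
Lemma central_bin_ratio_exp_le m k c : 0 <= c -> c <= ln m.*2.+1%:R ->
  ('C(m.*2, m)%:R / 4 ^+ m) ^+ k <= expR (- (k%:R / 2 * c)) :> R.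
Proof.
move=> c0 hc; have -> : - (k%:R / 2 * c) = k%:R * (- (c / 2)) by lra.
rewrite expRM_natl; apply: lerXn2r; rewrite ?nnegrE ?expR_ge0//.
rewrite -(ler_pXn2r (n := 2)) ?nnegrE ?expR_ge0 ?divr_ge0 ?exprn_ge0//.
apply: (le_trans (central_bin_ratio_sqr_le m)).
rewrite -expRM_natl; have -> : 2%:R * - (c / 2) = - c by lra.
by rewrite expRN lef_pV2 ?posrE ?expR_gt0// -[leRHS]lnK ?posrE// ler_expR.
Qed.

(* n = 2 e^t, so that the hypothesis on k reads k t >= 2 ln(2e) n. *)
Lemma large_bound n t k : n%:R = 2 * expR t :> R -> 0 < t ->
  2 * ln (2 * expR 1) * n%:R / t <= k%:R ->
  4 ^+ n * expR (- (k%:R / 2 * (7 / 8 * t))) <= expR (- (n%:R / 32)).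
Proof.
move=> nt t0; rewrite ler_pdivrMr// lnM ?posrE ?expR_gt0// expRK => hk.
have -> : 4 = expR (2%:R * ln 2) :> R by rewrite expRM_natl lnK ?posrE//; lra.
rewrite -expRM_natl -expRD ler_expR.
(* The exponent [2 n ln 2 - 7 k t / 16] is at most [n (9 ln 2 - 7) / 8], which is at most [-n/32]
   when [ln 2 <= 3/4]. *)
have := ln2_le; have n0 : 0 <= n%:R :> R by [].
move: hk n0; set N := n%:R; set K := k%:R; set l := ln 2 => hk n0 hl.
have : N * l <= N * (3 / 4) by apply: ler_wpM2l.
lra.
Qed.

(** With [E = e^(7t/8)], the count contributes at most [2 (t + 2) E] to the exponent. As
    [n = 2 E e^(t/8)], the hypothesis on [k] and [exp_dominates] give [k/4 >= E (2 (t + 2) + 1)].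
    What remains is at most [-E <= -t/2]. *)
Lemma small_bound n t k M : n%:R = 2 * expR t :> R -> 4000 <= t ->
  2 * ln (2 * expR 1) * n%:R / t <= k%:R -> M%:R <= expR (7 / 8 * t) ->
  n.+1%:R ^+ (M * 2) * expR (- (k%:R / 2 * 2^-1)) <= expR (- (t / 2)).
Proof.
move=> nt ht; rewrite lnM ?posrE ?expR_gt0// expRK => hk hM.
have t0 : 0 < t by lra.
have hn : n.+1%:R <= expR (t + 2).
  rewrite -natr1 nt expRD.
  have e2 : 3 <= expR 2 :> R by apply: le_trans (expR_ge1Dx _); lra.
  have := expR_ge1Dx t; nra.
have hn2 : n.+1%:R ^+ (M * 2) <= expR (2 * (t + 2) * expR (7 / 8 * t)).
  apply: (@le_trans _ _ (expR (t + 2) ^+ (M * 2))).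
    by apply: lerXn2r; rewrite ?nnegrE ?expR_ge0.
  rewrite -expRM_natl ler_expR natrM; nra.
apply: (le_trans (ler_wpM2r (expR_ge0 _) hn2)); rewrite -expRD ler_expR.
set E := expR (7 / 8 * t) in hM *.
have hE : expR t = E * expR (t / 8) by rewrite -expRD; congr expR; lra.
have tE : t <= 2 * E by have := expR_ge1Dx (7 / 8 * t); rewrite -/E; lra.
have ln2ge : 0 <= ln 2 :> R by apply: ln_ge0; lra.
have kE : 4 * E * (2 * (t + 2) + 1) <= k%:R.
  apply: le_trans hk; rewrite ler_pdivlMr// nt hE.
  have := exp_dominates _ ht; have E0 : 0 < E by exact: expR_gt0.
  move: (expR (t / 8)) => F hF.
  have h1 : E * (t * (2 * (t + 2) + 1)) <= E * F by rewrite ler_wpM2l// ltW.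
  have h2 : 0 <= ln 2 * (E * F).
    rewrite mulr_ge0// (le_trans _ h1)// mulr_ge0 ?ltW// mulr_gt0//; lra.
  lra.
nra.
Qed.

End Estimates.

Local Open Scope classical_set_scope.

(** * The finite union bound *)

Section FiniteUnions.
Variables (R : realType) (d : measure_display) (T : measurableType d).
Variable P : probability T R.

Lemma union_bound (I : finType) (A : pred I) (F : I -> set T) (E : set T) :
  (forall i, measurable (F i)) -> measurable E ->
  (forall w, E w -> exists2 i, A i & F i w) ->
  (P E <= \sum_(i | A i) P (F i))%E.
Proof.
move=> mF mE EF; set U := \big[setU/set0]_(i | A i) F i.
have mU : measurable U by exact: bigsetU_measurable.
apply: (@le_trans _ _ (P U)).
  rewrite le_measure ?inE// => w /EF[i Ai Fi].
  by rewrite /U (bigD1 i)//=; left.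
rewrite {mU}/U.
(* Measurability of the partial unions is carried through the induction, as subadditivity requires
   it at each step. *)
suff : measurable (\big[setU/set0]_(i | A i) F i) /\
    (P (\big[setU/set0]_(i | A i) F i) <= \sum_(i | A i) P (F i))%E by case.
elim/big_rec2 : _ => [|i y1 y2 Ai [m2 le21]]; first by rewrite measure0.
split; first exact: measurableU.
by apply: (le_trans (measureU2 P (mF i) m2)); apply: leeD2l.
Qed.

End FiniteUnions.

(** * The law of one binomial random subset *)

Section RandomSubset.
Variables (R : realType) (d : measure_display) (T : measurableType d).
Variables (P : probability T R) (X : finType) (r : T -> {set X}).
Hypotheses (mr : random_subset r) (br : binomial_half P r).

Lemma measurable_random_subset (Q : {set X} -> Prop) :
  measurable [set w | Q (r w)].
Proof. exact: (mr [set s | Q s]). Qed.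

(** Independence is given for membership events only, so avoidance is handled by induction on [|K|].
    Avoiding [y] is the difference of the event without a condition on [y] and the event with [y]
    added to [J], and [2^(-j) - 2^(-j-1) = 2^(-j-1)]. The base case is independence itself. *)
Lemma prob_cylinder (J K : {set X}) : [disjoint K & J]%B ->
  P [set w | J \subset r w /\ [disjoint K & r w]%B] =
  ((2^-1) ^+ (#|J| + #|K|))%:E.
Proof.
move En : #|K| => n; elim: n J K En => [|n IH] J K.
  move=> /eqP; rewrite cards_eq0 => /eqP -> _; rewrite addn0.
  have [half ind] := br.
  have -> : [set w | J \subset r w /\ [disjoint finset.set0 & r w]%B] =
      \bigcap_(i in [set` J]) [set w | i \in r w].
    apply/seteqP; split=> w /=.
      by move=> [/fintype.subsetP Jr _] i /= /Jr.
    move=> Jr; split; first by apply/fintype.subsetP => i /Jr.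
    by rewrite -setI_eq0 finset.set0I.
  rewrite ind (eq_bigr (fun=> (2^-1)%:E)) => [|i _]; last exact: half.
  by rewrite prodEFin prodr_const.
move=> cK dKJ.
have [y yK] : exists y, y \in K by apply/card_gt0P; rewrite cK.
have cK' : #|(K :\ y)%SET| = n by move: (cardsD1 y K); rewrite yK cK; lia.
have yJ : y \notin J by rewrite (disjointFr dKJ yK).
have dK'J : [disjoint (K :\ y)%SET & J]%B.
  by apply: disjointWl dKJ; exact: finset.subD1set.
have dK'yJ : [disjoint (K :\ y)%SET & (y |: J)%SET]%B.
  rewrite -setI_eq0; apply/eqP/setP => z; rewrite !inE.
  case: eqVneq => //= zy; have [zK|//] := boolP (z \in K).
  by rewrite (disjointFr dKJ zK).
have IH1 := IH J _ cK' dK'J; have IH2 := IH (y |: J)%SET _ cK' dK'yJ.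
have mE (J' K' : {set X}) :
    measurable [set w | J' \subset r w /\ [disjoint K' & r w]%B].
  exact: (measurable_random_subset (fun u => J' \subset u /\ [disjoint K' & u]%B)).
rewrite (_ : [set w | _] =
    [set w | J \subset r w /\ [disjoint (K :\ y)%SET & r w]%B] `\`
    [set w | (y |: J)%SET \subset r w /\ [disjoint (K :\ y)%SET & r w]%B]);
  last first.
  apply/seteqP; split=> w /=.
    move=> [Jr dKr]; split; first split => //.
      by apply: disjointWl dKr; exact: finset.subD1set.
    move=> [/fintype.subsetP/(_ y)]; rewrite !inE eqxx => /(_ isT).
    by rewrite (disjointFr dKr yK).
  move=> [[Jr dKr] nE]; split => //.
  have yr : y \notin r w.
    apply/negP => yr; apply: nE; split => //.
    by rewrite finset.subUset finset.sub1set yr.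
  rewrite -setI_eq0; apply/eqP/setP => z; rewrite !inE.
  have [->|zy] := eqVneq z y; first by rewrite (negbTE yr) andbF.
  have [zK|//] := boolP (z \in K).
  by rewrite (disjointFr dKr)// !inE zy.
rewrite measureD//; last first.
  by apply: (le_lt_trans (probability_le1 P (mE _ _))); rewrite ltry.
rewrite (_ : _ `&` _ =
    [set w | (y |: J)%SET \subset r w /\ [disjoint (K :\ y)%SET & r w]%B]);
  last first.
  apply/seteqP; split=> w /=; first by case.
  move=> [yJr dKr]; split => //; split => //.
  by apply: fintype.subset_trans yJr; exact: finset.subsetUr.
transitivity (((2^-1) ^+ (#|J| + n))%:E -
    ((2^-1) ^+ (#|(y |: J)%SET| + n))%:E : \bar R)%E.
  by congr (_ - _)%E; [exact: IH1|exact: IH2].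
rewrite -EFinB cardsU1 yJ /= add1n addSn addnS.
by congr EFin; rewrite !exprS; lra.
Qed.

(** So [r] is uniform on the power set: containing [s] and avoiding its complement is a cylinder
    event that fixes every point. *)
Lemma prob_eq (s : {set X}) : P [set w | r w = s] = ((2^-1) ^+ #|X|)%:E.
Proof.
rewrite -(cardsC s) -(@prob_cylinder s (~: s)%SET); last first.
  by rewrite -setI_eq0 finset.setIC finset.setICr.
congr (P _); apply/seteqP; split=> w /=.
  move=> ->; split => //.
  by rewrite -setI_eq0 finset.setIC finset.setICr.
move=> [sr d']; apply/eqP; rewrite finset.eqEsubset sr andbT.
by rewrite finset.disjoints_subset finset.setCS in d'.
Qed.

Lemma prob_mem_le (A : {set {set X}}) :
  (P [set w | r w \in A] <= (#|A|%:R / 2 ^+ #|X|)%:E)%E.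
Proof.
apply: (@le_trans _ _ (\sum_(s in A) P [set w | r w = s])).
  apply: union_bound => [s||w /= rA]; last by exists (r w).
    exact: (measurable_random_subset (fun u => u = s)).
  exact: (measurable_random_subset (fun u => u \in A)).
under eq_bigr do rewrite prob_eq.
by rewrite sumEFin sumr_const mulr_natl exprVn lexx.
Qed.

Lemma prob_balanced_le (a b : {set X}) : [disjoint a & b]%B -> #|a| = #|b| ->
  (P [set w | r w \in balanced X a b] <=
   ('C(#|a|.*2, #|a|)%:R / 4 ^+ #|a|)%:E)%E.
Proof.
move=> dab eab; apply: le_trans (prob_mem_le _) _; rewrite lee_fin.
rewrite ler_pdivrMr ?exprn_gt0// mulrAC ler_pdivlMr ?exprn_gt0//.
by rewrite -!natrX -!natrM ler_nat card_balanced_le.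
Qed.

End RandomSubset.

(** * The independent family, and the probability of not resolving *)

Section RandomFamily.
Variables (R : realType) (d : measure_display) (T : measurableType d).
Variables (P : probability T R) (X : finType) (k : nat).
Variable r : 'I_k -> T -> {set X}.
Hypotheses (mr : forall i, random_subset (r i))
  (br : forall i, binomial_half P (r i)) (ir : independent_subsets P r).

(** The family takes finitely many values, so the event is a finite union, over the values [f]
    satisfying [Q], of finite intersections of events [r i = f i]. *)
Lemma measurable_random_family (Q : ('I_k -> {set X}) -> Prop) :
  measurable [set w | Q (fun i => r i w)].
Proof.
rewrite (_ : [set w | _] = \bigcup_(f in [set f : {ffun 'I_k -> {set X}} | Q f])
   \bigcap_(i in [set: 'I_k]) (r i @^-1` [set f i])).
  apply: fin_bigcup_measurable => [|f _]; first exact: finite_finset.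
  apply: fin_bigcap_measurable => [|i _]; first exact: finite_finset.
  exact: mr.
have E w (f : {ffun 'I_k -> {set X}}) :
    (forall i, r i w = f i) -> (fun i => r i w) = f.
  by move=> rf; apply: funext.
apply/seteqP; split=> w /= => [Qw|[f Qf rf]].
  exists [ffun i => r i w] => [|i _] /=; last by rewrite ffunE.
  rewrite (_ : fun_of_fin _ = fun i => r i w)//.
  by apply: funext => i; rewrite ffunE.
by rewrite (E w f)// => i; exact: rf.
Qed.

Lemma prob_all_balanced_le (a b : {set X}) : [disjoint a & b]%B -> #|a| = #|b| ->
  (P [set w | forall i, r i w \in balanced X a b] <=
   (('C(#|a|.*2, #|a|)%:R / 4 ^+ #|a|) ^+ k)%:E)%E.
Proof.
move=> dab eab; have := ir (fun=> [set` balanced X a b]) [set: 'I_k]%SET.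
rewrite (_ : \bigcap_(i in _) _ = [set w | forall i, r i w \in balanced X a b]);
  last first.
  by apply/seteqP; split=> w /= H i; [apply: H; rewrite /= inE|move=> _; exact: H].
move=> ->; pose p i := fine (P (r i @^-1` [set` balanced X a b])).
have pE i : P (r i @^-1` [set` balanced X a b]) = (p i)%:E.
  by rewrite /p fineK// fin_num_measure//; exact: mr.
rewrite (eq_bigr (fun i => (p i)%:E)) => [|i _]; last exact: pE.
rewrite prodEFin lee_fin -[X in _ ^+ X]card_ord -cardsT -prodr_const.
apply: ler_prod => i _; rewrite -!lee_fin -pE measure_ge0 /=.
exact: prob_balanced_le.
Qed.

Lemma prob_not_resolves_le (x : X) : (1 < #|X|)%N ->
  (P (~` [set w | resolves R (landmarks x (fun i => r i w))]) <=
   (\sum_(p : {set X} * {set X} |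
        [&& [disjoint p.1 & p.2]%B, #|p.1| == #|p.2| & (0 < #|p.1|)%N])
      ('C(#|p.1|.*2, #|p.1|)%:R / 4 ^+ #|p.1|) ^+ k)%:E)%E.
Proof.
move=> X1; rewrite -sumEFin.
pose F (p : {set X} * {set X}) := [set w | forall i, r i w \in balanced X p.1 p.2].
apply: (@le_trans _ _ (\sum_(p : {set X} * {set X} |
  [&& [disjoint p.1 & p.2]%B, #|p.1| == #|p.2| & (0 < #|p.1|)%N]) P (F p))%E).
  apply: union_bound => [p||w /= nres].
  - exact: (measurable_random_family (fun f => forall i, f i \in balanced X p.1 p.2)).
  - exact/measurableC/(measurable_random_family (fun f => resolves R (landmarks x f))).
  (* Contrapositive: if no admissible pair is balanced for all [r i], the landmarks resolve. *)
  apply: contrapT => nF; apply: nres; apply: resolves_landmarks => // a b dab eab a0.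
  apply: contrapT => nb; apply: nF; exists (a, b) => /=.
    by rewrite dab eab eqxx -eab.
  by move=> i; apply: contrapT => /negP ri; apply: nb; exists i.
by apply: lee_sum => p /and3P[dp /eqP ep _]; exact: prob_all_balanced_le.
Qed.

End RandomFamily.

(** * The split of the union bound, and the limit *)

Lemma sum_ratio_le (R : realType) (X : finType) (k : nat) (t : R) :
  #|X|%:R = 2 * expR t -> 4000 <= t ->
  2 * ln (2 * expR 1) * #|X|%:R / t <= k%:R ->
  \sum_(p : {set X} * {set X} |
      [&& [disjoint p.1 & p.2]%B, #|p.1| == #|p.2| & (0 < #|p.1|)%N])
    ('C(#|p.1|.*2, #|p.1|)%:R / 4 ^+ #|p.1|) ^+ k
  <= expR (- (t / 2)) + expR (- (#|X|%:R / 32)) :> R.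
Proof.
move=> nt ht hk; have t0 : 0 < t by lra.
(* Since [e^t = n/2], this is the integer part of [(n/2)^(7/8)]. *)
pose M := Num.truncn (expR (7 / 8 * t)).
have /andP[Mle Mgt] := truncn_itv (expR_ge0 (7 / 8 * t)).
rewrite (bigID (fun p : {set X} * {set X} => (#|p.1| <= M)%N)) /=.
apply: lerD.
  apply: le_trans (small_bound R #|X| t k M nt ht hk Mle).
  pose S := [set a : {set X} | (#|a| <= M)%N]%SET.
  (* Both components have size at most [M], so the sum is enlarged to all of [S × S], whose
     cardinality is at most [(n + 1)^(2M)]. *)
  apply: (@le_trans _ _ (\sum_(p in finset.setX S S)
      expR (- (k%:R / 2 * 2^-1)) : R)).
    rewrite [leRHS](bigID (fun p : {set X} * {set X} =>
      [&& [disjoint p.1 & p.2]%B, #|p.1| == #|p.2| & (0 < #|p.1|)%N])) /=.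
    apply: ler_wpDr; first by apply: sumr_ge0 => *; exact: expR_ge0.
    rewrite [leLHS](eq_bigl (fun p : {set X} * {set X} => (p \in finset.setX S S) &&
      [&& [disjoint p.1 & p.2]%B, #|p.1| == #|p.2| & (0 < #|p.1|)%N])); last first.
      move=> p; rewrite !inE; case: eqVneq => [->|]; rewrite ?andbF//=.
      by rewrite andbb andbC.
    apply: ler_sum => p /andP[_ /and3P[_ _ p0]].
    (* As [m >= 1], [ln (2m + 1) >= ln 3 >= 1/2]. *)
    apply: central_bin_ratio_exp_le => //; apply: (le_trans (ln3_ge R)).
    by rewrite ler_ln ?posrE// ler_nat ltnS (leq_double 1).
  rewrite sumr_const -[leLHS]mulr_natl cardsX -natrX.
  apply: ler_wpM2r; first exact: expR_ge0.
  by rewrite ler_nat muln2 -addnn expnD leq_mul// card_small_sets.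
apply: le_trans (large_bound R #|X| t k nt t0 hk).
(* For large sets the sum is enlarged to all [4^n] pairs. *)
apply: (@le_trans _ _ (\sum_(p : {set X} * {set X})
    expR (- (k%:R / 2 * (7 / 8 * t))) : R)).
  rewrite [leRHS](bigID (fun p : {set X} * {set X} =>
    [&& [disjoint p.1 & p.2]%B, #|p.1| == #|p.2| & (0 < #|p.1|)%N]
      && ~~ (#|p.1| <= M)%N)) /=.
  apply: ler_wpDr; first by apply: sumr_ge0 => *; exact: expR_ge0.
  apply: ler_sum => p /andP[_]; rewrite -ltnNge => Mp.
  apply: central_bin_ratio_exp_le; first by lra.
  (* Here [e^(7t/8) < M + 1 <= 2m + 1], because [m > M]. *)
  rewrite -ler_expR lnK ?posrE//; apply: (le_trans (ltW Mgt)).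
  by rewrite ler_nat ltnS -addnn (leq_trans (ltnW Mp))// leq_addr.
have card2X : #|{set X}| = (2 ^ #|X|)%N.
  rewrite -[in RHS]cardsT -card_powerset -cardsT.
  by congr #|pred_of_set _|; apply/setP => s; rewrite !inE finset.subsetT.
rewrite sumr_const -[leLHS]mulr_natl card_prod card2X natrM.
rewrite natrX -exprMn; have -> : 2%:R * 2%:R = 4 :> R by lra.
by [].
Qed.

Theorem theorem1 (R : realType)
  (k : nefinType -> nat)
  (d : nefinType -> measure_display)
  (T : forall X : nefinType, measurableType (d X))
  (P : forall X : nefinType, probability (T X) R)
  (r : forall X : nefinType, 'I_(k X) -> T X -> {set X})
  (x : forall X : nefinType, X)
  (hk : forall X : nefinType,
     2 * ln (2 * expR 1) * #|X|%:R / ln (#|X|%:R / 2) <= (k X)%:R :> R)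
  (hmeas : forall (X : nefinType) (i : 'I_(k X)), random_subset (r X i))
  (hbin : forall (X : nefinType) (i : 'I_(k X)), binomial_half (P X) (r X i))
  (hind : forall X : nefinType, independent_subsets (P X) (r X)) :
  forall eps : R, 0 < eps -> exists N : nat, forall X : nefinType,
    (N <= #|X|)%N ->
    (`|P X [set w | resolves R (landmarks (x X) (fun i => r X i w))] - 1|
       < eps%:E)%E.
Proof.
(* The term 4000 serves [exp_dominates]; the term [4 / eps] makes [t / 2] at least [2 / eps], so
   that each of the two exponentials is below [eps / 2]. *)
move=> eps eps0; pose t0 : R := 4000 + 4 / eps.
have e4 : 0 < 4 / eps by rewrite divr_gt0.
exists (Num.truncn (2 * expR t0)).+1 => X nX; pose t : R := ln (#|X|%:R / 2).
have n_gt : 2 * expR t0 < #|X|%:R.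
  by apply: (lt_le_trans (truncnS_gt _)); rewrite ler_nat.
have n0 : 0 < #|X|%:R :> R by have := expR_gt0 t0; lra.
have nt : #|X|%:R = 2 * expR t.
  by rewrite /t lnK ?posrE ?divr_gt0//; lra.
have t_gt : t0 < t by rewrite -ltr_expR; lra.
have ht : 4000 <= t by rewrite /t0 in t_gt; lra.
have X1 : (1 < #|X|)%N.
  by rewrite -(ltr_nat R); have := expR_ge1Dx t; lra.
pose E := [set w | resolves R (landmarks (x X) (fun i => r X i w))].
have mE : measurable E.
  exact: (measurable_random_family _ _ _ _ _ (hmeas X)
    (fun f => resolves R (landmarks (x X) f))).
have nE := prob_not_resolves_le _ _ _ _ _ _ _ (hmeas X) (hbin X) (hind X) (x X) X1.
have sE := sum_ratio_le R X (k X) t nt ht (hk X).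
have e_t : (eps / 2)^-1 <= t / 2.
  by rewrite invf_div; rewrite /t0 in t_gt; lra.
have e_n : (eps / 2)^-1 <= #|X|%:R / 32.
  (* The claim [t/2 <= n/32 = e^t / 16] amounts to [8 t <= e^t], which follows from
     [t (2t + 5) <= e^(t/8)]. *)
  apply: (le_trans e_t); rewrite nt; have := exp_dominates R t ht.
  have : expR (t / 8) <= expR t by rewrite ler_expR; lra.
  nra.
have eps2 : 0 < eps / 2 by lra.
have b1 := expR_opp_lt R _ _ eps2 e_t.
have b2 := expR_opp_lt R _ _ eps2 e_n.
move: nE; rewrite -/E probability_setC//.
have PE : P X E = (fine (P X E))%:E by rewrite fineK// fin_num_measure.
have PE1 := probability_le1 (P X) mE.
move: PE1; rewrite -/E PE -EFinB !lee_fin => PE1 nE.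
by rewrite lte_fin ler0_norm; lra.
Qed.
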